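(* Let $\mathcal{G}$ be a connected RCOP block graph on $[n]$ with underlying graph $G$. Then the set of binomials $$\{\sigma_{ij}\sigma_{kl}-\sigma_{ik}\sigma_{jl} \;:\; E(i\leftrightarrow j)\uplus E(k\leftrightarrow l) = E(i\leftrightarrow k)\uplus E(j\leftrightarrow l)\}\ \cup\ \{\sigma_{ij}-\sigma_{kl} \;:\; \Lambda(i\leftrightarrow j)=\Lambda(k\leftrightarrow l)\}$$ (with $i,j,k,l\in[n]$, and multiset unions in the first set) is a Markov basis for, i.e. generates, the toric ideal $\ker(\varphi_{\mathcal{G}})$.
   Context: A colored graph $\mathcal{G}$ is a finite simple undirected graph on vertex set $[n]$ with a coloring $\lambda$ of its vertices and edges; $\Gamma(\mathcal{G})$ is the group of graph automorphisms preserving all vertex and edge colors. $\mathcal{G}$ is RCOP if the vertex colors and edge colors form disjoint sets, any two same-colored vertices are mapped to one another by some element of $\Gamma(\mathcal{G})$, and any two same-colored edges are mapped to one another by some element of $\Gamma(\mathcal{G})$. A graph on $[n]$ is a block graph if there is a vertex $c$ and a partition of $[n]$ into disjoint sets $A,B,\{c\}$ such that every path from $A$ to $B$ contains $c$, and the induced subgraphs on $A\cup\{c\}$ and $B\cup\{c\}$ are each complete graphs or block graphs. In a connected block graph any two vertices $u,v$ are joined by a unique shortest path $u\leftrightarrow v$; $E(u\leftrightarrow v)$ denotes its edge set and $\Lambda(u\leftrightarrow v)$ the multiset of the colors $\lambda(u)$, $\lambda(v)$ and the colors of the edges of $u\leftrightarrow v$. The shortest path map of $\mathcal{G}$ is the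 monomial map $\varphi_{\mathcal{G}}:\mathbb{R}[\sigma_{ij}: 1\le i\le j\le n]\to\mathbb{R}[t_\ell : \ell \text{ a color of } \mathcal{G}]$, $\sigma_{ij}\mapsto t_{\lambda(i)}t_{\lambda(j)}\prod_{e\in E(i\leftrightarrow j)} t_{\lambda(e)}$ (with $\sigma_{ji}=\sigma_{ij}$). A generating set of binomials of a toric ideal is called a Markov basis. *)

(* Defs.v *)
From HB Require Import structures.
From mathcomp Require Import all_boot all_order all_fingroup all_algebra.
From mathcomp Require Import reals.
From mathcomp Require Import mpoly.

Set Implicit Arguments.
Unset Strict Implicit.
Unset Printing Implicit Defensive.

Import GRing.Theory.
Local Open Scope ring_scope.

(* Only the values of [ecolor] on [edges] are meaningful. [color_used] makes C
   exactly the set of colors of the graph, so that a polynomial ring with one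
   variable per element of C is R[t_l : l a color of the graph]. *)
Record colored_graph (n : nat) (C : finType) := ColoredGraph {
  edges : {set {set 'I_n}};
  edges_card2 : {in edges, forall e : {set 'I_n}, #|e| = 2};
  vcolor : 'I_n -> C;
  ecolor : {set 'I_n} -> C;
  color_used : forall c : C,
    (exists i, vcolor i = c) \/ (exists2 e, e \in edges & ecolor e = c)
}.

Section Graph.
Variables (n : nat) (C : finType) (G : colored_graph n C).

Definition adj : rel 'I_n := [rel i j | [set i; j] \in edges G].

Definition connected_graph : Prop := forall u v : 'I_n, connect adj u v.

Definition color_aut : {set {perm 'I_n}} :=
  [set g : {perm 'I_n} |
    [&& [forall e : {set 'I_n}, ((g @: e) \in edges G) == (e \in edges G)],
        [forall i, vcolor G (g i) == vcolor G i]
      & [forall e in edges G, ecolor G (g @: e) == ecolor G e]]].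

Definition rcop : Prop :=
  [/\ (forall i e, e \in edges G -> vcolor G i <> ecolor G e),
      (forall i j, vcolor G i = vcolor G j ->
         exists2 g : {perm 'I_n}, g \in color_aut & g i = j)
    & (forall e f, e \in edges G -> f \in edges G -> ecolor G e = ecolor G f ->
         exists2 g : {perm 'I_n}, g \in color_aut & g @: e = f)].

Definition complete_on (S : {set 'I_n}) : Prop :=
  {in S &, forall i j, i != j -> adj i j}.

Definition separates_on (S A B : {set 'I_n}) (c : 'I_n) : Prop :=
  forall (a : 'I_n) (p : seq 'I_n),
    a \in A -> last a p \in B -> path adj a p -> {subset a :: p <= S} ->
    c \in a :: p.

(* [block_on S]: the subgraph induced on S is a block graph. The sets A and B
   may be empty, hence complete graphs are block graphs. *)
Inductive block_on (S : {set 'I_n}) : Prop :=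
  BlockOn (c : 'I_n) (A B : {set 'I_n}) of
      S = c |: (A :|: B)
    & c \notin A & c \notin B & [disjoint A & B]
    & separates_on S A B c
    & complete_on (c |: A) \/ block_on (c |: A)
    & complete_on (c |: B) \/ block_on (c |: B).

Definition block_graph : Prop := block_on [set: 'I_n].

(* As for [path], the start vertex u is not listed in p. *)
Definition walk (u v : 'I_n) (p : seq 'I_n) : bool :=
  path adj u p && (last u p == v).

(* The default value n is taken when u and v are not connected. *)
Definition dist (u v : 'I_n) : nat :=
  find (fun k => [exists p : k.-tuple 'I_n, walk u v p]) (iota 0 n).

(* A path of minimal length from u to v; it is unique in a connected block
   graph. The default [::] is taken when u and v are not connected. *)
Definition spath (u v : 'I_n) : seq 'I_n :=
  oapp val [::] [pick p : (dist u v).-tuple 'I_n | walk u v p].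

Lemma spathP (u v : 'I_n) : connect adj u v ->
  walk u v (spath u v) /\
  (forall q, walk u v q -> size (spath u v) <= size q)%N.
Proof.
move=> /connectP[p0 p0P v_last].
case/shortenP: p0P v_last => p pP up _ {p0} v_last.
pose Q k := [exists q : k.-tuple 'I_n, walk u v q].
have wQ q : walk u v q -> Q (size q).
  by move=> w; apply/existsP; exists (in_tuple q).
have wp : walk u v p by rewrite /walk pP v_last eqxx.
have szp : (size p < n)%N.
  by have := max_card (mem (u :: p)); rewrite (card_uniqP up) card_ord.
have hQ : has Q (iota 0 n).
  by apply/hasP; exists (size p); [rewrite mem_iota | apply: wQ].
have ltd : (dist u v < n)%N by move: hQ; rewrite has_find size_iota.
have Qd : Q (dist u v).
  by have := nth_find 0%N hQ; rewrite nth_iota ?add0n.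
rewrite /spath; case: pickP => [q wq | no] /=; last first.
  by case/existsP: Qd => q; rewrite no.
split=> // r /wQ Qr; rewrite size_tuple leqNgt; apply/negP => ltr.
by have := before_find 0%N ltr; rewrite nth_iota ?(ltn_trans ltr) // add0n -/(Q _) Qr.
Qed.

(* E(u <-> v), as a sequence listing the edges of the shortest path. *)
Definition spath_edges (u v : 'I_n) : seq {set 'I_n} :=
  pairmap (fun x y => [set x; y]) u (spath u v).

(* Lambda(u <-> v); multisets are sequences compared with [perm_eq]. *)
Definition spath_colors (u v : 'I_n) : seq C :=
  [:: vcolor G u, vcolor G v & map (ecolor G) (spath_edges u v)].

End Graph.

Definition upair (n : nat) := {p : 'I_n * 'I_n | (p.1 <= p.2)%N}.

Lemma upair_subproof (n : nat) (i j : 'I_n) :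
  let p := if (i <= j)%N then (i, j) else (j, i) in (p.1 <= p.2)%N.
Proof. by have [|/ltnW] := leqP i j. Qed.

Definition mk_upair (n : nat) (i j : 'I_n) : upair n :=
  exist _ (if (i <= j)%N then (i, j) else (j, i)) (upair_subproof i j).

Section Toric.
Variables (R : realType) (n : nat) (C : finType) (G : colored_graph n C).

(* R[sigma_ij : i <= j] and R[t_l : l a color], the variables being numbered
   by the canonical enumerations of the index types. *)
Definition sigma_ring := {mpoly R[#|{: upair n}|]}.
Definition color_ring := {mpoly R[#|C|]}.

Definition sigma (i j : 'I_n) : sigma_ring := 'X_(enum_rank (mk_upair i j)).

Definition tvar (c : C) : color_ring := 'X_(enum_rank c).

Definition spath_monomial (i j : 'I_n) : color_ring :=
  tvar (vcolor G i) * tvar (vcolor G j) *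
  \prod_(e <- spath_edges G i j) tvar (ecolor G e).

Definition shortest_path_map (f : sigma_ring) : color_ring :=
  f \mPo [tuple spath_monomial (val (enum_val k)).1 (val (enum_val k)).2
         | k < #|{: upair n}|].

Definition ker_shortest_path_map (f : sigma_ring) : Prop :=
  shortest_path_map f = 0.

Definition quadratic_binomials (f : sigma_ring) : Prop :=
  exists i j k l : 'I_n,
    perm_eq (spath_edges G i j ++ spath_edges G k l)
            (spath_edges G i k ++ spath_edges G j l) /\
    f = sigma i j * sigma k l - sigma i k * sigma j l.

Definition linear_binomials (f : sigma_ring) : Prop :=
  exists i j k l : 'I_n,
    perm_eq (spath_colors G i j) (spath_colors G k l) /\
    f = sigma i j - sigma k l.

Definition path_binomials (f : sigma_ring) : Prop :=
  quadratic_binomials f \/ linear_binomials f.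

End Toric.

Section MarkovBasis.
Variables (R : realType) (N : nat).
Implicit Types S I : {mpoly R[N]} -> Prop.

(* Differences of two monomials; the two monomials may coincide. *)
Definition is_binomial (f : {mpoly R[N]}) : Prop :=
  exists a b : 'X_{1..N}, f = 'X_[a] - 'X_[b].

Definition ideal_generated S (f : {mpoly R[N]}) : Prop :=
  exists (m : nat) (a g : 'I_m -> {mpoly R[N]}),
    (forall s, S (g s)) /\ f = \sum_(s < m) a s * g s.

Definition markov_basis S I : Prop :=
  (forall f, S f -> is_binomial f) /\
  (forall f, I f <-> ideal_generated S f).

End MarkovBasis.

(* Main.v *)
(** Let [btw u v w] say that [v] lies on a geodesic from [u] to [w].  In a connected
    block graph [btw u v w] means that [v] separates [u] from [w], so that for every
    [t] either [btw u v t] or [btw t v w]; all the geometry used below, including the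
    uniqueness of geodesics, follows from this.

    A color-preserving automorphism [g] never satisfies [btw x (g x) (g (g x))]
    unless [g x = x]: its iterates would push [x] arbitrarily far along a geodesic.

    By RCOP the colors are the orbits of vertices and edges.  Cut the geodesics of a
    product of variables at the visits of an orbit of vertices, and call the pieces of
    a visit its two halves (an outgoing edge, or the end of the geodesic).  The number
    of halves of each type is determined by the color monomial, and a pair of
    geodesics visiting the same vertex can exchange halves by a quadratic binomial,
    up to linear ones, whenever the exchanged halves lie in different branches.

    Let [a] and [b] be products with the same color monomial and [s_kl] a factor of
    [b].  Modulo the binomials, [a] acquires a factor [s_kj] whose geodesic agrees
    with that of [s_kl] up to a vertex [v], and [v] is then moved along the geodesic
    from [k] to [l].  The half needed at [v] occurs elsewhere in [a]; the exchange is
    blocked only if the two halves to be joined lie in one branch fixed by the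
    stabilizer of [v], and then counting the visits avoiding that branch provides a
    third pair of halves that unblocks it.  Once [v = l], the factor [s_kl] is
    cancelled. *)

Require Import Defs.
From mathcomp Require Import all_boot all_order all_fingroup all_algebra.
From mathcomp Require Import reals mpoly zify ring.

Set Implicit Arguments.
Unset Strict Implicit.
Unset Printing Implicit Defensive.

(** * Congruences modulo a generated ideal *)

Section GeneratedIdeal.
Local Open Scope ring_scope.
Import GRing.Theory.
Variables (R : realType) (N : nat) (S : {mpoly R[N]} -> Prop).
Implicit Types f g : {mpoly R[N]}.
Local Notation idl := (ideal_generated S).

Lemma ideal_gen f : S f -> idl f.
Proof.
by move=> Sf; exists 1%N, (fun=> 1), (fun=> f); rewrite big_ord1 mul1r.
Qed.

Lemma ideal_gen0 : idl 0.
Proof.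
by exists 0%N, (fun=> 0), (fun=> 0); rewrite big_ord0; split=> // -[].
Qed.

Lemma ideal_genD f g : idl f -> idl g -> idl (f + g).
Proof.
move=> [m1 [a1 [g1 [S1 ->]]]] [m2 [a2 [g2 [S2 ->]]]].
pose glue (F1 : 'I_m1 -> {mpoly R[N]}) F2 (s : 'I_(m1 + m2)) :=
  match split s with inl i => F1 i | inr i => F2 i end.
have glueL F1 F2 i : glue F1 F2 (lshift m2 i) = F1 i.
  by rewrite /glue (unsplitK (inl _ i)).
have glueR F1 F2 i : glue F1 F2 (rshift m1 i) = F2 i.
  by rewrite /glue (unsplitK (inr _ i)).
exists (m1 + m2)%N, (glue a1 a2), (glue g1 g2); split.
  by move=> s; rewrite /glue; case: (split s).
rewrite big_split_ord /=; congr (_ + _); apply: eq_bigr => i _.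
  by rewrite !glueL.
by rewrite !glueR.
Qed.

Lemma ideal_genM f g : idl g -> idl (f * g).
Proof.
move=> [m [a [s [Ss ->]]]]; exists m, (fun i => f * a i), s; split=> //.
by rewrite mulr_sumr; apply: eq_bigr => i _; rewrite mulrA.
Qed.

Definition cong f g := idl (f - g).

Lemma cong_refl f : cong f f.
Proof. by rewrite /cong subrr; apply: ideal_gen0. Qed.

Lemma cong_sym f g : cong f g -> cong g f.
Proof. by move=> /(ideal_genM (-1)); rewrite /cong mulN1r opprB. Qed.

Lemma cong_trans g f h : cong f g -> cong g h -> cong f h.
Proof. by move=> fg /(ideal_genD fg); rewrite addrA subrK. Qed.

Lemma congM f f' g g' : cong f f' -> cong g g' -> cong (f * g) (f' * g').
Proof.
move=> ff gg; rewrite /cong.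
have -> : f * g - f' * g' = g * (f - f') + f' * (g - g').
  by rewrite !mulrBr addrA (mulrC g f') subrK mulrC.
by apply: ideal_genD; apply: ideal_genM.
Qed.

End GeneratedIdeal.

(** * Geodesics in block graphs *)

Section RcopBlockGraph.
Variables (n : nat) (C : finType) (G : colored_graph n C).
Implicit Types (u v w t x y : 'I_n) (p q : seq 'I_n).

Lemma adjC u v : adj G u v = adj G v u.
Proof. by rewrite /adj /= setUC. Qed.

Lemma adj_neq u v : adj G u v -> u != v.
Proof.
move=> /= uv; apply/eqP => euv; have := edges_card2 uv.
by rewrite euv setUid cards1.
Qed.

Lemma walk_cat u v w p q : walk G u v p -> walk G v w q -> walk G u w (p ++ q).
Proof.
move=> /andP[up /eqP lp] /andP[vq lq].
by rewrite /walk cat_path last_cat up lp vq lq.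
Qed.

Lemma walk_rev u v p : walk G u v p -> walk G v u (rev (belast u p)).
Proof.
move=> /andP[up /eqP <-]; rewrite /walk rev_path.
under eq_path do rewrite adjC.
rewrite up /=; case: p {up} => [|x p] //=.
by rewrite rev_cons last_rcons.
Qed.

Lemma walk_split u w p1 p2 :
  walk G u w (p1 ++ p2) -> walk G u (last u p1) p1 /\ walk G (last u p1) w p2.
Proof. by rewrite /walk cat_path last_cat eqxx => /andP[/andP[-> ->] ->]. Qed.

Lemma closed_walk (X : {set 'I_n}) v a b p :
    (forall x y, x \in X -> y \notin X -> y != v -> ~~ adj G x y) ->
    v \notin X -> walk G a b p -> v \notin a :: p -> (a \in X) = (b \in X).
Proof.
move=> clX vX; elim: p a => [|y p IH] a; first by case/andP=> _ /eqP <-.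
case/andP=> /= /andP[ay py] lp; rewrite inE negb_or => /andP[va vyp].
rewrite -(IH y) /walk ?py //; move: va vyp; rewrite inE negb_or => va /andP[vy _].
apply/idP/idP => h; apply/negPn/negP => h'.
  by have := clX _ _ h h'; rewrite ay eq_sym vy => /(_ isT).
by have := clX _ _ h h'; rewrite adjC ay eq_sym va => /(_ isT).
Qed.

(** Induction on the decomposition: if [u] and [w] lie on one side of [c], the separator found there
    is extended; if [c] splits them, then [v = c] and one side serves. *)
Lemma block_separator (S : {set 'I_n}) : block_on G S ->
  {in S & &, forall u v w, adj G u v -> adj G v w -> u != w -> ~~ adj G u w ->
    exists X : {set 'I_n}, [/\ u \in X, v \notin X, w \notin X
      & forall x y, x \in X -> y \in S -> y \notin X -> y != v -> ~~ adj G x y]}.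
Proof.
pose sep (S : {set 'I_n}) u v w := exists X : {set 'I_n},
  [/\ u \in X, v \notin X, w \notin X
    & forall x y, x \in X -> y \in S -> y \notin X -> y != v -> ~~ adj G x y].
have glue c (A B : {set 'I_n}) : c \notin B ->
    [disjoint A & B] -> {in A & B, forall x y, ~~ adj G x y} ->
    complete_on G (c |: A) \/ {in c |: A & &, forall u v w, adj G u v ->
       adj G v w -> u != w -> ~~ adj G u w -> sep (c |: A) u v w} ->
    forall u v w, u \in c |: A -> w \in c |: A -> v \in c |: (A :|: B) ->
    adj G u v -> adj G v w -> u != w -> ~~ adj G u w ->
    sep (c |: (A :|: B)) u v w.
  move=> cB dAB nAB HA u v w uA wA vS uv vw nuw auw.
  have vA : v \in c |: A.
    move: vS; rewrite setUA inE => /orP[//|vB].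
    have toc x : x \in c |: A -> adj G x v -> x = c.
      by rewrite !inE => /orP[/eqP //|xA]; rewrite (negPf (nAB _ _ xA vB)).
    by rewrite (toc u uA uv) (toc w wA) ?eqxx // in nuw; rewrite adjC.
  case: HA => [cmp|HA]; first by rewrite cmp in auw.
  have [X [uX vX wX clX]] := HA _ _ _ uA vA wA uv vw nuw auw.
  have notB x : x \in c |: A -> x \notin B.
    rewrite !inE => /orP[/eqP -> //|xA]; by rewrite (disjointFr dAB xA).
  (* [B] is attached only at [c], so it joins the side of [c]; the intersection discards points that
     [X] may have outside [c |: A]. *)
  exists ((X :&: (c |: A)) :|: (if c \in X then B else set0)); split.
  - by rewrite !inE uX; move: uA; rewrite !inE => ->.
  - by rewrite inE negb_or inE (negPf vX) /=; case: ifP; rewrite ?notB // inE.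
  - by rewrite inE negb_or inE (negPf wX) /=; case: ifP; rewrite ?notB // inE.
  move=> x y; rewrite [x \in _]inE => xX yS yX yv; apply/negP => xy.
  move: yX; rewrite inE negb_or => /andP[yX yB].
  move: yS; rewrite setUA inE => yS.
  have edgeB a b : a \in c |: A -> b \in B -> adj G a b -> a = c.
    by rewrite !inE => /orP[/eqP //|aA bB]; rewrite (negPf (nAB _ _ aA bB)).
  case/orP: xX => [/setIP[xX xA]|xB].
    case/orP: yS => yS.
      move: yX; rewrite inE yS andbT => yX.
      by have := clX _ _ xX yS yX yv; rewrite xy.
    by move: yB; rewrite -(edgeB _ _ xA yS xy) xX yS.
  move: xB yB; case: ifP => cX; last by rewrite inE.
  move=> xB /negPf yB; move: yS; rewrite yB orbF => yA.
  move: xy; rewrite adjC => xy; move: yX; rewrite (edgeB _ _ yA xB xy).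
  by rewrite !inE cX eqxx.
(* The recursive occurrences of [block_on] sit under a disjunction, hence the explicit fixpoint. *)
move: S; fix IH 2 => S [c A B -> cA cB dAB sAB HA HB].
have nAB : {in A & B, forall x y, ~~ adj G x y}.
  move=> x y xA yB; apply/negP => xy.
  have sub : {subset [:: x; y] <= c |: (A :|: B)}.
    by move=> z; rewrite !inE => /orP[]/eqP->; rewrite ?xA ?yB ?orbT.
  have := sAB x [:: y] xA yB; rewrite /= andbT => /(_ xy sub).
  rewrite !inE => /orP[]/eqP e; first by rewrite e xA in cA.
  by rewrite e yB in cB.
have nBA : {in B & A, forall x y, ~~ adj G x y}.
  by move=> x y xB yA; rewrite adjC nAB.
have {}HA : complete_on G (c |: A) \/ {in c |: A & &, forall u v w, adj G u v ->
       adj G v w -> u != w -> ~~ adj G u w -> sep (c |: A) u v w}.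
  by case: HA => [h|h]; [left | right; apply: (IH _ h)].
have {}HB : complete_on G (c |: B) \/ {in c |: B & &, forall u v w, adj G u v ->
       adj G v w -> u != w -> ~~ adj G u w -> sep (c |: B) u v w}.
  by case: HB => [h|h]; [left | right; apply: (IH _ h)].
have dBA : [disjoint B & A] by rewrite disjoint_sym.
have sepC u v w : sep (c |: (B :|: A)) u v w -> sep (c |: (A :|: B)) u v w.
  by rewrite (setUC B).
move=> u v w uS vS wS uv vw nuw auw.
have mid (A' B' : {set 'I_n}) : c |: (A' :|: B') = c |: (A :|: B) ->
    {in A' & B', forall x y, ~~ adj G x y} -> c \notin A' -> [disjoint A' & B'] ->
    u \in A' -> w \in B' -> sep (c |: (A :|: B)) u v w.
  move=> eS nAB' cA' dAB' uA wB.
  have ev : v = c.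
    move: vS; rewrite -eS !inE => /orP[/eqP //|/orP[vA|vB]].
      by have := nAB' _ _ vA wB; rewrite vw.
    by have := nAB' _ _ uA vB; rewrite uv.
  exists A'; rewrite ev; split=> //.
    by rewrite (disjointFl dAB' wB).
  move=> x y xA; rewrite -eS !inE => yS yA yc; move: yS.
  by rewrite (negPf yA) (negPf yc) /=; apply: nAB'.
move: (uS) (wS); rewrite !inE.
have inl (D : {set 'I_n}) x : x \in D -> x \in c |: D by rewrite inE orbC => ->.
have inc (D : {set 'I_n}) : c \in c |: D by rewrite !inE eqxx.
have gA := glue _ _ _ cB dAB nAB HA u v w.
have gB := glue _ _ _ cA dBA nBA HB u v w.
rewrite (setUC B) in gB.
move=> /orP[/eqP eu|/orP[uA|uB]] /orP[/eqP ew|/orP[wA|wB]].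
- by apply: gA; rewrite // ?eu ?ew.
- by apply: gA; rewrite // ?eu // inl.
- by apply: gB; rewrite // ?eu // inl.
- by apply: gA; rewrite // ?ew // inl.
- by apply: gA; rewrite // inl.
- by apply: (mid A B).
- by apply: gB; rewrite // ?ew // inl.
- by apply: (mid B A) => //; rewrite (setUC B).
- by apply: gB; rewrite // inl.
Qed.


(** * Distance and betweenness *)

Hypothesis Gconnected : connected_graph G.

Definition gdist u v := size (spath G u v).

Lemma walk_spath u v : walk G u v (spath G u v).
Proof. by have [] := spathP (Gconnected u v). Qed.

Lemma gdist_min u v q : walk G u v q -> gdist u v <= size q.
Proof. by have [_] := spathP (Gconnected u v); apply. Qed.

Lemma gdistxx u : gdist u u = 0.
Proof.
by apply/eqP; rewrite -leqn0; apply: (gdist_min (q := [::])); rewrite /walk eqxx.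
Qed.

Lemma gdist_eq0 u v : gdist u v = 0 -> u = v.
Proof.
rewrite /gdist => /size0nil e; have := walk_spath u v.
by rewrite e => /andP[_ /eqP].
Qed.

Lemma gdist_triangle v u w : gdist u w <= gdist u v + gdist v w.
Proof.
rewrite -size_cat; apply: gdist_min.
exact: walk_cat (walk_spath _ _) (walk_spath _ _).
Qed.

Lemma gdistC u v : gdist u v = gdist v u.
Proof.
by apply/eqP; rewrite eqn_leq; apply/andP; split;
  rewrite (leq_trans (gdist_min (walk_rev (walk_spath _ _)))) // size_rev size_belast.
Qed.

Lemma gdist_adj u v : adj G u v -> gdist u v = 1.
Proof.
move=> uv; apply/eqP; rewrite eqn_leq; apply/andP; split.
  by apply: (gdist_min (q := [:: v])); rewrite /walk /= eqxx; move: uv => /= ->.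
by rewrite lt0n; apply/eqP => /gdist_eq0 e; move: (adj_neq uv); rewrite e eqxx.
Qed.

Definition btw u v w := gdist u v + gdist v w == gdist u w.

Lemma btwC u v w : btw u v w = btw w v u.
Proof. by rewrite /btw addnC (gdistC u v) (gdistC v w) (gdistC u w). Qed.

Lemma btwxx u w : btw u u w.
Proof. by rewrite /btw gdistxx. Qed.

Lemma btwx u w : btw u w w.
Proof. by rewrite btwC btwxx. Qed.

Lemma geodesic_split u w p1 p2 :
  walk G u w (p1 ++ p2) -> size (p1 ++ p2) = gdist u w ->
  [/\ btw u (last u p1) w, gdist u (last u p1) = size p1
    & gdist (last u p1) w = size p2].
Proof.
move=> /walk_split[w1 w2]; rewrite size_cat => e.
have := gdist_min w1; have := gdist_min w2; have := gdist_triangle (last u p1) u w.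
by rewrite /btw => *; split; [apply/eqP|..]; lia.
Qed.

Lemma mem_geodesic u v w : v \in u :: spath G u w -> btw u v w.
Proof.
move: (walk_spath u w) (erefl (gdist u w)); rewrite {2}/gdist => wp ep vp.
case/splitPl: vp wp ep => p1 p2 <- wp ep.
by have [] := geodesic_split wp (esym ep).
Qed.

Lemma gdist_nxt v u : v != u ->
  exists x p, [/\ spath G v u = x :: p, walk G x u p, adj G v x
                & gdist v u = (gdist x u).+1].
Proof.
move=> vu; have wp := walk_spath v u; have e := erefl (gdist v u); move: wp e.
rewrite {2}/gdist; case: (spath G v u) => [|x p] wp e.
  by move: vu wp; rewrite /walk /= => /negPf ->.
have e' := geodesic_split (p1 := [:: x]) (p2 := p) wp (esym e).
have [w1 w2] := walk_split (p1 := [:: x]) (p2 := p) wp.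
exists x, p; split=> //; last by case: e' => /eqP <- -> ->.
by move: w1; rewrite /walk /= => /andP[/andP[]].
Qed.

Hypothesis Gblock : block_graph G.

(* Removing [v] disconnects [u] from [w] as soon as [v] lies strictly between them,
   so [t] cannot be in the component of both. *)
Lemma btw_cut t u v w : btw u v w -> btw u v t || btw t v w.
Proof.
move=> b; have [<-|vu] := eqVneq v u; first by rewrite btwxx.
have [<-|vw] := eqVneq v w; first by rewrite btwx orbT.
have [x [p [ep wp vx dx]]] := gdist_nxt vu.
have [y [q [eq wq vy dy]]] := gdist_nxt vw.
(* An edge between these neighbors of [v] would bypass [v]; so [block_separator] applies to them. *)
have dxy : 2 <= gdist x y.
  have := gdist_triangle x u w; have := gdist_triangle y x w.
  by move: b; rewrite /btw (gdistC u v) (gdistC u x) => /eqP; lia.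
have nxy : x != y by apply/eqP => e; move: dxy; rewrite e gdistxx.
have axy : ~~ adj G x y by apply/negP => /gdist_adj e; move: dxy; rewrite e.
have [X [xX vX yX clX]] : exists X : {set 'I_n}, [/\ x \in X, v \notin X, y \notin X
   & forall x y, x \in X -> y \notin X -> y != v -> ~~ adj G x y].
  have [] := block_separator Gblock (in_setT x) (in_setT v) (in_setT y) _ vy nxy axy.
    by rewrite adjC.
  move=> X [xX vX yX clX]; exists X; split=> // a c aX; exact: clX (in_setT _).
(* A geodesic leaving [v] never returns to it, so [closed_walk] applies to the rest of it. *)
have nov a r c : gdist v a = (gdist c a).+1 -> spath G v a = c :: r ->
    walk G c a r -> v \notin c :: r.
  move=> da ea wr; apply/negP => vr.
  move: (erefl (gdist v a)); rewrite {2}/gdist ea /= => sr.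
  case/splitPl: vr wr sr => r1 r2 er wr sr; have [_ w2] := walk_split wr.
  rewrite er in w2; have := gdist_min w2; move: sr; rewrite size_cat => ->.
  by rewrite ltnNge leq_addl.
have uX : u \in X.
  by rewrite -(closed_walk clX vX wp) // (nov u).
have wX : w \notin X.
  by rewrite -(closed_walk clX vX wq) // (nov w).
case tX : (t \in X).
  rewrite (mem_geodesic (u := t)) ?orbT //; apply/negPn/negP => h.
  by move: wX; rewrite -(closed_walk clX vX (walk_spath t w) h) tX.
rewrite (mem_geodesic (u := u)) //; apply/negPn/negP => h.
by have := closed_walk clX vX (walk_spath u t) h; rewrite tX uX.
Qed.

(** By [btw_cut] the first vertex [x] of one geodesic lies between [u] and the first vertex [y] of
    the other, or between [y] and [w]; the distances being equal, [x = y]. *)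
Lemma geodesic_uniq u w p q :
  walk G u w p -> walk G u w q -> size p = gdist u w -> size q = gdist u w -> p = q.
Proof.
elim: p q u => [|x p IH] [|y q] u //=; try by move=> _ _ <-.
move=> wp wq sp sq.
have [bx dx dxw] := geodesic_split (p1 := [:: x]) (p2 := p) wp sp.
have [by_ dy dyw] := geodesic_split (p1 := [:: y]) (p2 := q) wq sq.
have [_ wp'] := walk_split (p1 := [:: x]) (p2 := p) wp.
have [_ wq'] := walk_split (p1 := [:: y]) (p2 := q) wq.
rewrite /= in bx dx dxw by_ dy dyw wp' wq'.
have e : x = y.
  apply: gdist_eq0; have := btw_cut y bx; rewrite /btw (gdistC y x).
  by case/orP => /eqP; lia.
by rewrite -e in wq' dyw *; rewrite (IH q x).
Qed.

Lemma spath_cat u v w : btw u v w -> spath G u w = spath G u v ++ spath G v w.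
Proof.
move=> b; apply: (geodesic_uniq (walk_spath u w)) => //.
  exact: walk_cat (walk_spath _ _) (walk_spath _ _).
by rewrite size_cat; apply/eqP.
Qed.

(** This names the branch at [u] containing [w]; the default [u] makes the end of a geodesic a half
    of its own type. *)
Definition nxt u w := head u (spath G u w).

Lemma spathxx u : spath G u u = [::].
Proof. by apply/size0nil/gdistxx. Qed.

Lemma nxtxx u : nxt u u = u.
Proof. by rewrite /nxt spathxx. Qed.

Lemma nxtP u w : u != w ->
  [/\ adj G u (nxt u w), btw u (nxt u w) w
    & spath G u w = nxt u w :: spath G (nxt u w) w].
Proof.
move=> uw; have [x [p [e wp ux d]]] := gdist_nxt uw.
have b : btw u x w by rewrite /btw gdist_adj // d.
rewrite /nxt e; split=> //=; congr (_ :: _).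
apply: (geodesic_uniq wp (walk_spath _ _)) => //.
by move: d; rewrite {1}/gdist e => -[].
Qed.

Lemma nxt_eq u w : nxt u w = u -> w = u.
Proof.
move=> e; apply/eqP; apply/negPn/negP; rewrite eq_sym => /nxtP[/adj_neq].
by rewrite e eqxx.
Qed.

Lemma nxt_btw u v w : btw u v w -> v != u -> nxt u v = nxt u w.
Proof.
by rewrite eq_sym => b /nxtP[_ _ e]; rewrite /nxt (spath_cat b) e.
Qed.

Lemma nxt_adj u w : adj G u w -> nxt u w = w.
Proof.
move=> uw; have [a /eqP b _] := nxtP (adj_neq uw); apply: gdist_eq0.
by move: b; rewrite (gdist_adj uw) (gdist_adj a) => -[].
Qed.

Lemma btw_not u v w : btw v u w -> u != v -> ~~ btw u v w.
Proof.
move=> /eqP b; apply: contraNN => /eqP b'; apply/eqP/gdist_eq0.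
by move: b b'; rewrite (gdistC v u); lia.
Qed.

Lemma btw_sideL t u v w : btw u v w -> ~~ btw u v t -> btw t v w.
Proof. by move/(btw_cut t)/orP => [->|]. Qed.

Lemma btw_sideR t u v w : btw u v w -> ~~ btw t v w -> btw u v t.
Proof. by move/(btw_cut t)/orP => [|->]. Qed.

(** [~~ btw u v w] expresses that [u] and [w] lie in one branch at [v]. *)
Lemma side_trans u v w t : ~~ btw u v w -> ~~ btw w v t -> ~~ btw u v t.
Proof. by move=> uw wt; apply/negP => /btw_sideL/(_ uw); apply/negP. Qed.

Lemma btw_nxt u v j l : nxt v j = nxt v l -> btw u v j -> btw u v l.
Proof.
have [<-|vj] := eqVneq v j.
  by rewrite nxtxx => /esym/nxt_eq ->.
move=> e b; have [a b1 _] := nxtP vj; have nv := adj_neq a.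
have vl : v != l by apply/eqP => h; move: nv; rewrite e -h nxtxx eqxx.
have [_ b2 _] := nxtP vl; rewrite -e in b2; rewrite eq_sym in nv.
have s1 := btw_not b1 nv; have s2 := btw_not b2 nv.
by apply: (btw_sideR (btw_sideR b s1)); rewrite btwC.
Qed.

Lemma btw_trans u v w t : btw u v t -> btw v w t -> btw u w t.
Proof.
rewrite /btw => /eqP b1 /eqP b2; apply/eqP.
have := gdist_triangle v u w; have := gdist_triangle w u t; lia.
Qed.

Lemma btw_transl u v w t : btw u v t -> btw v w t -> btw u v w.
Proof.
rewrite /btw => /eqP b1 /eqP b2; apply/eqP.
have := gdist_triangle v u w; have := gdist_triangle w u t; lia.
Qed.

(** Gluing overlapping geodesics fails in general graphs. Here [btw_cut] would otherwise put [w]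
    between [v] and [u], while [v] is between [u] and [w], so that [v = w]. *)
Lemma btw_extend u v w t : btw u v w -> btw v w t -> v != w -> btw u w t.
Proof.
move=> b1 b2 vw; apply: (btw_sideL b2); apply/negP => b3.
move/eqP: vw; apply; apply: gdist_eq0; move: b1 b3.
by rewrite /btw (gdistC w u) (gdistC v u) => /eqP ? /eqP; lia.
Qed.

Lemma btw_extendl u v w t : btw u v w -> btw v w t -> v != w -> btw u v t.
Proof.
move=> b1 b2 vw; rewrite btwC.
by apply: (@btw_extend t w v u); rewrite // 1?btwC // eq_sym.
Qed.

Lemma btw_mid u v w t : btw u v w -> btw u w t -> btw v w t.
Proof.
rewrite /btw => /eqP b1 /eqP b2; apply/eqP.
have := gdist_triangle v u t; have := gdist_triangle w v t; lia.
Qed.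

(** * Automorphisms *)

Lemma color_aut_group_set : group_set (color_aut G).
Proof.
apply/group_setP; split.
  have im1 (e : {set 'I_n}) : [set (1%g : {perm 'I_n}) x | x in e] = e.
    by under eq_imset do rewrite perm1; rewrite imset_id.
  rewrite inE; apply/and3P; split; apply/forallP => e.
  - by rewrite im1.
  - by rewrite perm1.
  - by apply/implyP; rewrite im1.
move=> g h; rewrite !inE => /and3P[/forallP g1 /forallP g2 /forallP g3].
move=> /and3P[/forallP h1 /forallP h2 /forallP h3].
have imM (e : {set 'I_n}) : [set (g * h)%g x | x in e] = h @: (g @: e).
  by rewrite -imset_comp; apply: eq_imset => x; rewrite permM.
apply/and3P; split; apply/forallP => e.
- by rewrite imM (eqP (h1 _)) (eqP (g1 _)).
- by rewrite permM (eqP (h2 _)) (eqP (g2 _)).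
apply/implyP => eE; rewrite imM.
have ge : g @: e \in edges G by rewrite (eqP (g1 _)).
by rewrite (eqP (implyP (h3 _) ge)) (eqP (implyP (g3 _) eE)).
Qed.

Canonical color_aut_group := Group color_aut_group_set.

Implicit Types (g h : {perm 'I_n}) (c : C).
Local Notation Gam := (color_aut G).

Lemma imset_pair g x y : g @: [set x; y] = [set g x; g y].
Proof. by rewrite imsetU !imset_set1. Qed.

Lemma adj_aut g u v : g \in Gam -> adj G (g u) (g v) = adj G u v.
Proof.
by rewrite inE => /and3P[/forallP h _ _]; rewrite /adj /= -imset_pair (eqP (h _)).
Qed.

Lemma vcolor_aut g u : g \in Gam -> vcolor G (g u) = vcolor G u.
Proof. by rewrite inE => /and3P[_ /forallP h _]; apply/eqP. Qed.

Lemma ecolor_aut g (e : {set 'I_n}) :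
  g \in Gam -> e \in edges G -> ecolor G (g @: e) = ecolor G e.
Proof.
by rewrite inE => /and3P[_ _ /forallP h] eE; apply/eqP; apply: implyP (h e) eE.
Qed.

Lemma walk_aut g u v p : g \in Gam -> walk G u v p -> walk G (g u) (g v) (map g p).
Proof.
move=> gG /andP[up /eqP <-]; rewrite /walk last_map eqxx andbT path_map.
by rewrite (eq_path (e' := adj G)) // => x y; rewrite /= adj_aut.
Qed.

Lemma gdist_aut g u v : g \in Gam -> gdist (g u) (g v) = gdist u v.
Proof.
have le h x y : h \in Gam -> gdist (h x) (h y) <= gdist x y.
  move=> hG; have := gdist_min (walk_aut hG (walk_spath x y)).
  by rewrite size_map.
move=> gG; apply/eqP; rewrite eqn_leq le //=.
by have := le g^-1%g (g u) (g v); rewrite !permK groupV; apply.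
Qed.

Lemma btw_aut g u v w : g \in Gam -> btw (g u) (g v) (g w) = btw u v w.
Proof. by move=> gG; rewrite /btw !gdist_aut. Qed.

Lemma spath_aut g u v : g \in Gam -> spath G (g u) (g v) = map g (spath G u v).
Proof.
move=> gG; apply: (geodesic_uniq (walk_spath _ _)) => //.
  exact: walk_aut (walk_spath u v).
by rewrite size_map gdist_aut.
Qed.

(* Otherwise the iterates of [g] would move [x] arbitrarily far along a geodesic. *)
Lemma no_translation g x : g \in Gam -> g x != x -> ~~ btw x (g x) (g (g x)).
Proof.
move=> gG gx; apply/negP => b.
pose y m := (g ^+ m)%g x.
have yS m : y m.+1 = g (y m) by rewrite /y expgSr permM.
have yd m : gdist (y m) (y m.+1) = gdist x (g x).
  by rewrite /y expgS permM gdist_aut // groupX.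
have by_ m : btw x (y m.+1) (y m.+2).
  elim: m => [|m IH]; first by rewrite !yS /y expg0 perm1.
  apply: (btw_extend IH).
    by rewrite /y (expgS g m.+2) (expgS g m.+1) !permM btw_aut // groupX.
  apply/eqP => e; have := yd m.+1; rewrite -e gdistxx => /esym/gdist_eq0 e'.
  by rewrite -e' eqxx in gx.
have dm m : gdist x (y m.+1) = m.+1 * gdist x (g x).
  elim: m => [|m IH]; first by rewrite mul1n yS /y perm1.
  by have /eqP <- := by_ m; rewrite IH yd mulSn addnC.
(* At the order of [g] the iterate is [x] itself, so a positive multiple of [gdist x (g x)]
   vanishes. *)
have := dm (#[g]%g).-1; rewrite prednK ?order_gt0 // /y expg_order perm1 gdistxx.
move=> /esym/eqP; rewrite muln_eq0 -leqn0 leqNgt order_gt0 /= => /eqP/gdist_eq0 e.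
by rewrite -e eqxx in gx.
Qed.

(** * Edges and colors along a geodesic *)

Lemma spath_edges_btw u v w :
  btw u v w -> spath_edges G u w = spath_edges G u v ++ spath_edges G v w.
Proof.
move=> b; rewrite /spath_edges (spath_cat b) pairmap_cat.
by have /andP[_ /eqP ->] := walk_spath u v.
Qed.

Lemma spath_edges_nxt u w : u != w ->
  spath_edges G u w = [set u; nxt u w] :: spath_edges G (nxt u w) w.
Proof. by move=> /nxtP[_ _ e]; rewrite /spath_edges e /=. Qed.

Lemma spath_edgesxx u : spath_edges G u u = [::].
Proof. by rewrite /spath_edges spathxx. Qed.

Lemma spath_edges_adj u w : adj G u w -> spath_edges G u w = [:: [set u; w]].
Proof.
move=> uw; rewrite spath_edges_nxt ?(adj_neq uw) //.
by rewrite nxt_adj // spath_edgesxx.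
Qed.

Lemma nxt_ind (P : 'I_n -> 'I_n -> Prop) :
  (forall u, P u u) -> (forall u w, u != w -> P (nxt u w) w -> P u w) ->
  forall u w, P u w.
Proof.
move=> P0 PS u w; have [m] := ubnP (gdist u w); elim: m u => // m IH u lem.
have [->|uw] := eqVneq u w; first exact: P0.
apply: PS => //; apply: IH; have [a /eqP b _] := nxtP uw.
by move: lem; rewrite -b gdist_adj // ltnS.
Qed.

Lemma spath_edgesC u v : perm_eq (spath_edges G u v) (spath_edges G v u).
Proof.
move: u v; apply: nxt_ind => [u|u w uw IH]; first exact: perm_refl.
have [a b _] := nxtP uw; rewrite btwC in b.
rewrite spath_edges_nxt // (spath_edges_btw b) perm_sym.
rewrite (spath_edges_adj (u := nxt u w)) 1?adjC // setUC.
by rewrite perm_catC /= perm_cons perm_sym.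
Qed.

Lemma spath_edges_sub u v e : e \in spath_edges G u v -> e \in edges G.
Proof.
move: u v; apply: nxt_ind => [u|u w uw IH]; first by rewrite spath_edgesxx.
rewrite spath_edges_nxt // inE => /orP[/eqP ->|//].
by have [] := nxtP uw.
Qed.

Lemma spath_edges_aut g u v : g \in Gam ->
  spath_edges G (g u) (g v) = [seq g @: (e : {set 'I_n}) | e <- spath_edges G u v].
Proof.
move=> gG; rewrite /spath_edges spath_aut //.
by move: (spath G u v) => p; elim: p u => //= x p IH u; rewrite IH imset_pair.
Qed.

Definition ncol c u v := count_mem c (map (ecolor G) (spath_edges G u v)).

Lemma ncol_btw c u v w : btw u v w -> ncol c u w = ncol c u v + ncol c v w.
Proof. by move=> b; rewrite /ncol (spath_edges_btw b) map_cat count_cat. Qed.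

Lemma ncolC c u v : ncol c u v = ncol c v u.
Proof. exact/seq.permP/perm_map/spath_edgesC. Qed.

Lemma ncol_aut c g u v : g \in Gam -> ncol c (g u) (g v) = ncol c u v.
Proof.
move=> gG; rewrite /ncol spath_edges_aut // -map_comp; congr count.
by apply/eq_in_map => e /spath_edges_sub eE /=; rewrite ecolor_aut.
Qed.

Lemma spath_colorsE i j k l :
  (forall c, (vcolor G i == c) + (vcolor G j == c) + ncol c i j =
             (vcolor G k == c) + (vcolor G l == c) + ncol c k l) ->
  perm_eq (spath_colors G i j) (spath_colors G k l).
Proof.
by move=> h; apply/allP => c _; apply/eqP; rewrite /= !addnA.
Qed.

Lemma spath_colorsC i j : perm_eq (spath_colors G i j) (spath_colors G j i).
Proof. by apply: spath_colorsE => c; rewrite ncolC (addnC (vcolor G i == c)). Qed.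

Lemma spath_colors_aut g i j : g \in Gam ->
  perm_eq (spath_colors G i j) (spath_colors G (g i) (g j)).
Proof. by move=> gG; apply: spath_colorsE => c; rewrite ncol_aut ?vcolor_aut. Qed.

Hypothesis Grcop : rcop G.

(** * Counting the halves of geodesics *)

Section Weights.
Local Open Scope ring_scope.
Import Order.TTheory GRing.Theory Num.Theory.

Definition edge_weight (om : C -> int) u w : int :=
  \sum_(e <- spath_edges G u w) om (ecolor G e).

Lemma edge_weightxx om u : edge_weight om u u = 0.
Proof. by rewrite /edge_weight spath_edgesxx big_nil. Qed.

Lemma edge_weight_nxt om u w : u != w ->
  edge_weight om u w = om (ecolor G [set u; nxt u w]) + edge_weight om (nxt u w) w.
Proof. by move=> uw; rewrite /edge_weight spath_edges_nxt // big_cons. Qed.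

Lemma edge_weight_btw om u v w :
  btw u v w -> edge_weight om u w = edge_weight om u v + edge_weight om v w.
Proof. by move=> b; rewrite /edge_weight (spath_edges_btw b) big_cat. Qed.

Lemma edge_weightN om u w : edge_weight (fun c => - om c) u w = - edge_weight om u w.
Proof. exact: sumrN. Qed.

Variables (W : 'I_n -> 'I_n -> int).
Hypothesis W_aut : forall g x y, g \in Gam -> W (g x) (g y) = W x y.

(** By [Grcop] colors are orbits and vertex colors differ from edge colors, so an invariant weight
    of halves descends to colors. An automorphism may exchange the ends of an edge, hence the
    symmetric sum. *)
Lemma color_weight : exists om : C -> int,
  (forall i, om (vcolor G i) = W i i) /\
  (forall x y, adj G x y -> om (ecolor G [set x; y]) = W x y + W y x).
Proof.
case: Grcop => Gdisj Gv Ge.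
pose om c : int := if [pick i | vcolor G i == c] is Some i then W i i
  else if [pick e : 'I_n * 'I_n |
             adj G e.1 e.2 && (ecolor G [set e.1; e.2] == c)] is Some e
  then W e.1 e.2 + W e.2 e.1 else 0.
exists om; split=> [i | x y xy]; rewrite /om.
  case: pickP => [k /eqP e|/(_ i)]; last by rewrite eqxx.
  by have [g gG <-] := Gv _ _ e; rewrite W_aut.
case: pickP => [k /eqP e|_]; first by case: (Gdisj k _ xy).
case: pickP => [[a b] /andP[ab /eqP e]|/(_ (x, y))]; last first.
  by rewrite eqxx andbT xy.
have [g gG] := Ge _ _ ab xy e; rewrite imset_pair => es.
have ngab : g a != g b by rewrite (inj_eq perm_inj) (adj_neq ab).
have := set21 (g a) (g b); have := set22 (g a) (g b); rewrite es !inE.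
case/orP=> /eqP eb /orP[]/eqP ea; rewrite ?ea ?eb ?eqxx // in ngab.
  by rewrite -ea -eb !W_aut // addrC.
by rewrite -ea -eb !W_aut.
Qed.

Hypothesis W_btw : forall x y t, btw x y t -> y != x -> W x y = W x t.

(** Regrouped by vertices, the left side is [W v j] plus the visits [W x v + W x j] at the other
    vertices [x] of the geodesic. *)
Lemma half_path_weight_le (om : C -> int) v j :
  (forall i, om (vcolor G i) = W i i) ->
  (forall x y, adj G x y -> om (ecolor G [set x; y]) = W x y + W y x) ->
  (forall x, btw v x j -> x != v -> W x v + W x j <= 0) ->
  edge_weight om v j + om (vcolor G j) <= W v j.
Proof.
move=> omv ome; move: v j; apply: nxt_ind => [u|u w uw IH] Hx.
  by rewrite edge_weightxx add0r omv.
have [a b _] := nxtP uw; move: (nxt u w) a b (edge_weight_nxt om uw) IH => x a b ex IH.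
have xu : x != u by rewrite eq_sym (adj_neq a).
rewrite ex ome // -(W_btw b xu).
have Hxw := Hx x b xu.
suff : edge_weight om x w + om (vcolor G w) <= W x w.
  by lia.
apply: IH => y by_ yx.
have bu := btw_trans b by_; have := btw_transl b by_; rewrite btwC => bxy.
rewrite (W_btw bxy) 1?eq_sym //; apply: Hx => //.
apply/eqP => e; move: by_; rewrite e.
by apply/negP; apply: btw_not.
Qed.

End Weights.

Definition color_seq (a : seq ('I_n * 'I_n)) : seq C :=
  flatten [seq spath_colors G z.1 z.2 | z <- a].

Lemma color_seq_cons z a : color_seq (z :: a) = spath_colors G z.1 z.2 ++ color_seq a.
Proof. by []. Qed.

Section Visits.
Local Open Scope ring_scope.
Import Order.TTheory GRing.Theory Num.Theory.
Variables (W : 'I_n -> 'I_n -> int).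
Hypothesis W_aut : forall g x y, g \in Gam -> W (g x) (g y) = W x y.
Hypothesis W_btw : forall x y t, btw x y t -> y != x -> W x y = W x t.
Hypothesis W_visit : forall i x j, btw i x j -> 0 <= W x i + W x j.

(* [W x y] weighs the half at [x] of a geodesic from [x] to [y]; both alternatives
   locate a visit outside the common part of the geodesics from [k] to [v]. *)
Lemma visit_count k j l v a b :
  btw k v j -> btw k v l ->
  perm_eq (color_seq ((k, j) :: a)) (color_seq ((k, l) :: b)) ->
  W v j < W v l ->
  (exists2 z, z \in a & exists2 x, btw z.1 x z.2 & 0 < W x z.1 + W x z.2) \/
  (exists x, [/\ btw v x j, x != v & 0 < W x v + W x j]).
Proof.
move=> bj bl pab ltW.
have [om [omv ome]] := color_weight W_aut.
pose F u w := edge_weight om u w.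
pose T (z : 'I_n * 'I_n) := \sum_(c <- spath_colors G z.1 z.2) om c.
have TE i i' : T (i, i') = W i i + (F i i' + om (vcolor G i')).
  by rewrite /T /= !big_cons big_map omv -/(edge_weight om i i') -/(F i i'); lia.
have Fle u w : (forall x, btw u x w -> x != u -> W x u + W x w <= 0) ->
   F u w + om (vcolor G w) <= W u w.
  exact: half_path_weight_le.
(* The upper bound for the opposite weight, whose visits are nonpositive by [W_visit]. *)
have Fge u w : W u w <= F u w + om (vcolor G w).
  have := @half_path_weight_le (fun x y => - W x y) _ (fun c => - om c) u w.
  rewrite edge_weightN -opprD lerN2; apply.
  - by move=> x y t h1 h2; congr (- _); apply: W_btw.
  - by move=> i; rewrite omv.
  - by move=> x y xy; rewrite ome // opprD.
  - by move=> x bx _; rewrite -opprD oppr_le0; apply: W_visit.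
have FD u x w : btw u x w -> F u w = F u x + F x w.
  exact: edge_weight_btw.
have Tge z : 0 <= T z.
  by case: z => i i'; rewrite TE; have := Fge i i'; have := W_visit (btwxx i i'); lia.
have sumT s : \sum_(z <- s) T z = \sum_(c <- color_seq s) om c.
  by rewrite /color_seq big_flatten big_map.
have := perm_big _ pab (op := +%R) (x := 0%R) (P := xpredT) (F := om).
rewrite /= -!sumT !big_cons !TE (FD _ _ _ bj) (FD _ _ _ bl) => eT.
have Tb : 0 <= \sum_(z <- b) T z by apply: sumr_ge0 => z _; apply: Tge.
pose vis (z : 'I_n * 'I_n) := [exists x, btw z.1 x z.2 && (0 < W x z.1 + W x z.2)].
have [/hasP[z qa /existsP[x /andP[bx Wx]]]|/hasPn na] := boolP (has vis a).
  by left; exists z => //; exists x.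
have [/existsP[x /and3P[bx nx Wx]]|np] :=
    boolP [exists x, [&& btw v x j, x != v & 0 < W x v + W x j]].
  by right; exists x.
have Ta : \sum_(z <- a) T z <= 0.
  rewrite big_seq; apply: sumr_le0 => -[i i'] qa; rewrite TE.
  have vq x : btw i x i' -> W x i + W x i' <= 0.
    move=> bx; rewrite leNgt; apply/negP => Wx.
    by move/negP: (na _ qa); apply; apply/existsP; exists x; rewrite bx.
  have := vq _ (btwxx i i'); have := Fle i i' (fun x bx _ => vq x bx); lia.
have vP : F v j + om (vcolor G j) <= W v j.
  apply: Fle => x bx nx; rewrite leNgt; apply/negP => Wx.
  by move/negP: np; apply; apply/existsP; exists x; rewrite bx nx.
(* Now [a] weighs at most zero and [b] at least zero, while the piece from [v] to [j] weighs at most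
   [W v j], strictly less than the piece from [v] to [l]. *)
move: eT Ta Tb (Fge v l) vP ltW.
by move: (\sum_(z <- a) _) (\sum_(z <- b) _) => A B; lia.
Qed.

End Visits.

(* For [P x y] of the form [(x == v) && Q y] this says that a half at [x] directed
   towards [y] has, up to automorphism, the type described by [v] and [Q]. *)
Definition aut_sat (P : rel 'I_n) x y := [exists g in Gam, P (g x) (g y)].

Lemma aut_satP (P : rel 'I_n) x y :
  reflect (exists2 g, g \in Gam & P (g x) (g y)) (aut_sat P x y).
Proof.
by apply: (iffP existsP) => [[g /andP[]]|[g gG Pg]]; exists g; rewrite ?gG.
Qed.

Lemma aut_sat_aut (P : rel 'I_n) g x y :
  g \in Gam -> aut_sat P (g x) (g y) = aut_sat P x y.
Proof.
move=> gG; apply/aut_satP/aut_satP => -[h hG Ph].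
  by exists (g * h)%g; rewrite ?groupM // !permM.
by exists (g^-1 * h)%g; rewrite ?groupM ?groupV // !permM !permK.
Qed.

Lemma aut_sat_btw (P : rel 'I_n) :
  (forall x y t, btw x y t -> y != x -> P x y = P x t) ->
  forall x y t, btw x y t -> y != x -> aut_sat P x y = aut_sat P x t.
Proof.
move=> HP x y t b yx; apply: eq_existsb => g; case gG : (g \in Gam) => //=.
by apply: HP; rewrite ?btw_aut // (inj_eq perm_inj).
Qed.

(** This is [no_translation] read at [v = g x]: [x] and [g v] lie in one branch at [v]. *)
Lemma not_btw_aut v x g : g \in Gam -> x != v -> g x = v -> ~~ btw x v (g v).
Proof.
by move=> gG xv gx; have := no_translation (x := x) gG; rewrite gx eq_sym; apply.
Qed.

Section Existence.
Variables (k j l v : 'I_n) (a b : seq ('I_n * 'I_n)).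
Hypothesis bkj : btw k v j.
Hypothesis bkl : btw k v l.
Hypothesis col_ab : perm_eq (color_seq ((k, j) :: a)) (color_seq ((k, l) :: b)).

(** [visit_count] for the indicator of the orbit of the half at [v] towards [l]; in the first case
    the half towards [j] already has this type. *)
Lemma exists_half :
  [\/ exists2 h, h \in Gam & h v = v /\ nxt v (h j) = nxt v l,
      exists2 z, z \in a & exists g x, [/\ g \in Gam, btw z.1 x z.2, g x = v
        & nxt v (g z.1) = nxt v l \/ nxt v (g z.2) = nxt v l]
    | exists g x, [/\ g \in Gam, btw v x j, x != v, g x = v
        & nxt v (g v) = nxt v l \/ nxt v (g j) = nxt v l]].
Proof.
pose P x y := (x == v) && (nxt v y == nxt v l).
pose W x y : int := Posz (aut_sat P x y).
have W_aut g x y : g \in Gam -> W (g x) (g y) = W x y.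
  by move=> gG; rewrite /W aut_sat_aut.
have W_btw x y t : btw x y t -> y != x -> W x y = W x t.
  move=> bx yx; congr (Posz (nat_of_bool _)); apply: aut_sat_btw bx yx.
  move=> {}x {}y {}t bx yx; rewrite /P; case: eqVneq => //= e; subst x.
  by rewrite (nxt_btw bx).
have Wl : W v l = 1%R.
  by rewrite /W; case: aut_satP => // -[]; exists 1%g; rewrite // !perm1 /P !eqxx.
case Pj : (aut_sat P v j).
  by case/aut_satP: Pj => h hG /andP[/eqP hv /eqP hj]; constructor 1; exists h.
have W_visit i x i' : btw i x i' -> (0 <= W x i + W x i')%R by rewrite /W; lia.
have [|[z za [x bx]]|[x [bx xv]]] := visit_count W_aut W_btw W_visit bkj bkl col_ab.
- by rewrite Wl /W Pj.
- rewrite /W; case: aut_satP => [[g gG /andP[/eqP gx /eqP e]] _|_].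
    by constructor 2; exists z => //; exists g, x; split=> //; left.
  case: aut_satP => [[g gG /andP[/eqP gx /eqP e]] _|_ //].
  by constructor 2; exists z => //; exists g, x; split=> //; right.
- rewrite /W; case: aut_satP => [[g gG /andP[/eqP gx /eqP e]] _|_].
    by constructor 3; exists g, x; split=> //; left.
  case: aut_satP => [[g gG /andP[/eqP gx /eqP e]] _|_ //].
  by constructor 3; exists g, x; split=> //; right.
Qed.

Hypothesis bjl : btw j v l.
Hypothesis fix_j : forall h, h \in Gam -> h v = v -> ~~ btw j v (h j).

(** The visit of [v] on the way from [k] to [j] has a half in the branch of [j], and its half
    towards [l] would not be there; equality of colors forces a compensating visit in [a]. *)
Lemma exists_avoiding : exists2 z, z \in a & exists g x,
  [/\ g \in Gam, btw z.1 x z.2, g x = v, btw j v (g z.1) & btw j v (g z.2)].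
Proof.
pose Po x (y : 'I_n) := x == v.
pose Pz x y := (x == v) && ~~ btw j v y.
(* A visit of weight 2 avoids the branch of [j]; every other visit has weight 0. *)
pose W x y : int :=
  if aut_sat Po x y then if aut_sat Pz x y then (-1)%R else 1%R else 0%R.
have W_aut g x y : g \in Gam -> W (g x) (g y) = W x y.
  by move=> gG; rewrite /W !aut_sat_aut.
have W_btw x y t : btw x y t -> y != x -> W x y = W x t.
  move=> bx yx; rewrite /W (aut_sat_btw (P := Po) _ bx yx) //.
  rewrite (aut_sat_btw _ bx yx) // => {}x {}y {}t {}bx {}yx.
  rewrite /Pz; case: eqVneq => //= e; subst x.
  have := btw_not bx yx => nb; congr (~~ _); apply/idP/idP => h.
    by apply: (btw_sideR h); rewrite btwC.
  exact: (btw_sideR h).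
have fix_z g y : g \in Gam -> g v = v -> ~~ btw j v y -> ~~ btw j v (g y).
  move=> gG gv jy; apply: side_trans (fix_j gG gv) _.
  by rewrite -{1}gv btw_aut.
have zP x y g : g \in Gam -> g x = v -> aut_sat Pz x y = ~~ btw j v (g y).
  move=> gG gx; apply/aut_satP/idP => [[h hG /andP[/eqP hx hy]]|h].
    have := @fix_z (h^-1 * g)%g (h y); rewrite !permM permK; apply=> //.
      by rewrite groupM ?groupV.
    by rewrite -{1}hx permK.
  by exists g; rewrite /Pz ?gx ?eqxx.
have oP x y g : g \in Gam -> g x = v -> aut_sat Po x y.
  by move=> gG gx; apply/aut_satP; exists g; rewrite /Po ?gx.
have W_orb x y : (exists2 g, g \in Gam & g x = v) \/ W x y = 0%R.
  rewrite /W; case: aut_satP => [[g gG /eqP gx]|_]; last by right.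
  by left; exists g.
have WE x y g : g \in Gam -> g x = v ->
    W x y = if btw j v (g y) then 1%R else (-1)%R.
  by move=> gG gx; rewrite /W (oP x y g) // (zP x y g) //; case: btw.
(* The two halves of a visit are never both in the branch of [j], so their weights add up to 0 or 2;
   off the orbit of [v] they vanish. *)
have W_visit i x i' : btw i x i' -> (0 <= W x i + W x i')%R.
  move=> bx; case: (W_orb x i) => [[g gG gx]|W0]; last first.
    case: (W_orb x i') => [[g gG gx]|->]; last by rewrite W0.
    by move: W0; rewrite (WE _ _ g) //; case: btw.
  rewrite !(WE _ _ g) //; move: bx; rewrite -(btw_aut _ _ _ gG) gx.
  by move=> /(btw_cut j); rewrite btwC => /orP[]->; case: btw.
have Wpos x y y' : (0 < W x y + W x y')%R ->
    exists2 g, g \in Gam & [/\ g x = v, btw j v (g y) & btw j v (g y')].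
  case: (W_orb x y) => [[g gG gx]|W0]; last first.
    case: (W_orb x y') => [[g gG gx]|->]; last by rewrite W0.
    by move: W0; rewrite (WE _ _ g) //; case: btw.
  by rewrite !(WE _ _ g) // => H; exists g => //; move: H; do 2 case: btw.
have [|[z za [x bx /Wpos[g gG [gx g1 g2]]]]|[x [bx xv]]] :=
    visit_count W_aut W_btw W_visit bkj bkl col_ab.
- rewrite !(WE v _ 1%g) ?perm1 // bjl.
  by have := fix_j (group1 _) (perm1 v); rewrite perm1 => /negPf ->.
- by exists z => //; exists g, x.
(* Such a visit cannot avoid the branch of [j]: [x] lies in it, hence so does [g v] by
   [not_btw_aut]. *)
- move=> /Wpos[g gG [gx gv _]]; have nb := btw_not bx xv.
  have := not_btw_aut gG xv gx; rewrite (btw_sideL gv) //.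
  by rewrite btwC.
Qed.

End Existence.

Variable R : realType.

(** * Exchanging halves modulo the path binomials *)

Section Moves.
Local Open Scope ring_scope.
Import GRing.Theory.
Local Notation "f ~= g" := (cong (@path_binomials R n C G) f g)
  (at level 70, no associativity).
Local Notation sg := (@sigma R n).

Lemma sigmaC i j : sg i j = sg j i.
Proof.
rewrite /sigma; congr ('X_(enum_rank _)); apply: val_inj => /=.
by case: ltngtP => // /val_inj ->.
Qed.

Lemma sigma_lin i j k l :
  perm_eq (spath_colors G i j) (spath_colors G k l) -> sg i j ~= sg k l.
Proof. by move=> h; apply: ideal_gen; right; exists i, j, k, l. Qed.

Lemma sigma_aut g i j : g \in Gam -> sg i j ~= sg (g i) (g j).
Proof. by move=> gG; apply/sigma_lin/spath_colors_aut. Qed.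

(** Colors add up over the two pieces at [v], so the stabilizer of [v] may move each piece
    independently while they stay in different branches. *)
Lemma sigma_half_aut g h g' h' v i j :
  g \in Gam -> h \in Gam -> g v = v -> h v = v ->
  g' \in Gam -> h' \in Gam -> g' v = v -> h' v = v ->
  btw (g i) v (h j) -> btw (g' i) v (h' j) -> sg (g i) (h j) ~= sg (g' i) (h' j).
Proof.
move=> gG hG gv hv g'G h'G g'v h'v b1 b2; apply/sigma_lin/spath_colorsE => c.
rewrite (ncol_btw _ b1) (ncol_btw _ b2) !vcolor_aut //; congr (_ + (_ + _))%N.
  by rewrite -{1}gv -[in RHS]g'v !ncol_aut.
by rewrite -{1}hv -[in RHS]h'v !ncol_aut.
Qed.

Lemma sigma_swap v i j k l : btw i v j -> btw k v l -> btw i v l -> btw k v j ->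
  sg i j * sg k l ~= sg i l * sg k j.
Proof.
move=> b1 b2 b3 b4; apply: ideal_gen; left; exists i, j, l, k; split; last first.
  by rewrite (sigmaC l k) (sigmaC j k).
rewrite (spath_edges_btw b1) (spath_edges_btw b3).
move: b2 b4; rewrite btwC => b2; rewrite btwC => b4.
rewrite (spath_edges_btw b2) (spath_edges_btw b4).
apply/seq.permP => P; rewrite !count_cat.
rewrite (seq.permP (spath_edgesC v j)) (seq.permP (spath_edgesC l v)).
by lia.
Qed.

(* The last alternative is needed when the orbit of the branch of [j'] consists of
   that branch and the branch of [i'] only. *)
Lemma swap_fix v i j i' j' h :
  h \in Gam -> h v = v -> btw i v j -> ~~ btw i v j' -> btw i v (h j') ->
  exists h1, [/\ h1 \in Gam, h1 v = v, btw i v (h1 j')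
               & btw i' v (h1 j') \/ btw (h1 i') v j].
Proof.
move=> hG hv bij nb bh.
have hVv : h^-1%g v = v by rewrite -{1}hv permK.
have [b|nb1] := boolP (btw i' v (h j')); first by exists h; split=> //; left.
have bhV : btw i v (h^-1%g j').
  have : btw (h^-1%g j') (h^-1%g v) (h^-1%g (h j')).
    by rewrite btw_aut ?groupV // (btw_sideL bh).
  by rewrite hVv permK => b; rewrite btwC; apply: (btw_sideR b).
have [b|nb2] := boolP (btw i' v (h^-1%g j')).
  by exists h^-1%g; split; rewrite ?groupV //; left.
(* Both [h] and its inverse send [j'] into the branch of [i'], so [h i'] lies in the branch of [j'],
   which is that of [i] and not that of [j]. *)
exists h; split=> //; right; apply: (btw_sideL bij).
apply: side_trans nb _; rewrite btwC.
by rewrite -(btw_aut _ _ _ hG) hv permKV in nb2.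
Qed.

(** A direct [sigma_swap] may join two ends of one branch; [swap_fix] provides a stabilizer element
    that first moves one of the geodesics out of the way. *)
Lemma sigma_swap_stab v i j k l g h :
  g \in Gam -> g v = v -> h \in Gam -> h v = v ->
  btw i v j -> btw k v l -> btw i v (g l) -> btw k v (h j) ->
  sg i j * sg k l ~= sg i (g l) * sg k (h j).
Proof.
have half g1 h1 g2 h2 x y : g1 \in Gam -> g1 v = v -> h1 \in Gam -> h1 v = v ->
    g2 \in Gam -> g2 v = v -> h2 \in Gam -> h2 v = v ->
    btw (g1 x) v (h1 y) -> btw (g2 x) v (h2 y) -> sg (g1 x) (h1 y) ~= sg (g2 x) (h2 y).
  by move=> *; apply: (sigma_half_aut (v := v)).
have halfr g1 g2 x y : g1 \in Gam -> g1 v = v -> g2 \in Gam -> g2 v = v ->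
    btw x v (g1 y) -> btw x v (g2 y) -> sg x (g1 y) ~= sg x (g2 y).
  by move=> *; have := @half 1%g g1 1%g g2 x y; rewrite !perm1; apply; rewrite ?group1.
have halflr g1 g2 x y : g1 \in Gam -> g1 v = v -> g2 \in Gam -> g2 v = v ->
    btw (g1 x) v y -> btw x v (g2 y) -> sg (g1 x) y ~= sg x (g2 y).
  by move=> *; have := @half g1 1%g 1%g g2 x y; rewrite !perm1; apply; rewrite ?group1.
have half1 g1 x y : g1 \in Gam -> g1 v = v -> btw x v y -> btw x v (g1 y) ->
    sg x y ~= sg x (g1 y).
  by move=> *; have := @halfr 1%g g1 x y; rewrite !perm1; apply; rewrite ?group1.
(* The case in which only the half towards [j0] needs a stabilizer element. *)
have main i0 j0 k0 l0 h0 : h0 \in Gam -> h0 v = v -> btw i0 v j0 -> btw k0 v l0 ->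
    btw i0 v l0 -> btw k0 v (h0 j0) ->
    sg i0 j0 * sg k0 l0 ~= sg i0 l0 * sg k0 (h0 j0).
  move=> hG hv bij bkl bil bkhj; have [b|nb] := boolP (btw k0 v j0).
    apply: cong_trans (sigma_swap bij bkl bil b) _.
    by apply: congM (cong_refl _ _) _; apply: half1.
  have [h1 [h1G h1v b1 [b2|b2]]] := swap_fix i0 hG hv bkl nb bkhj.
    apply: cong_trans (congM (half1 h1 _ _ _ _ _ _) (cong_refl _ _)) _ => //.
    apply: cong_trans (sigma_swap b2 bkl bil b1) _.
    by apply: congM (cong_refl _ _) _; apply: halfr.
  have bh : btw (h1 i0) v (h1 j0) by rewrite -{1}h1v btw_aut.
  apply: cong_trans (congM (sigma_aut _ _ h1G) (cong_refl _ _)) _.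
  apply: cong_trans (sigma_swap bh bkl b2 b1) _.
  apply: congM; last exact: halfr.
  by have := @halflr h1 1%g i0 l0; rewrite !perm1; apply; rewrite ?group1.
move=> gG gv hG hv bij bkl bigl bkhj; have [b|nb] := boolP (btw i v l).
  apply: cong_trans (main _ _ _ _ h _ _ _ _ _ _) _ => //.
  by apply: congM (half1 _ _ _ _ _ _ _) (cong_refl _ _).
have [h1 [h1G h1v b1 [b2|b2]]] := swap_fix k gG gv bij nb bigl.
  apply: cong_trans (congM (cong_refl _ _) (half1 h1 _ _ _ _ _ _)) _ => //.
  apply: cong_trans (main _ _ _ _ h _ _ _ _ _ _) _ => //.
  by apply: congM (halfr _ _ _ _ _ _ _ _ _ _) (cong_refl _ _).
have bh : btw (h1 k) v (h1 l) by rewrite -{1}h1v btw_aut.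
apply: cong_trans (congM (cong_refl _ _) (sigma_aut _ _ h1G)) _.
apply: cong_trans (sigma_swap bij bh b1 b2) _.
by apply: congM; [apply: halfr | apply: halflr].
Qed.

Definition mon (a : seq ('I_n * 'I_n)) := \prod_(z <- a) sg z.1 z.2.

Lemma mon_rem z a : z \in a -> mon a = sg z.1 z.2 * mon (rem z a).
Proof. by move=> za; rewrite /mon (perm_big _ (perm_to_rem za)) big_cons. Qed.

Lemma mon_cons z a : mon (z :: a) = sg z.1 z.2 * mon a.
Proof. by rewrite /mon big_cons. Qed.

(** * Extending the common part of two geodesics *)

Section Step.
Variables (k j l v : 'I_n) (a b : seq ('I_n * 'I_n)).
Hypothesis bkj : btw k v j.
Hypothesis bkl : btw k v l.
Hypothesis col_ab : perm_eq (color_seq ((k, j) :: a)) (color_seq ((k, l) :: b)).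

(** One step of [v] towards [l]. For [v = l] the last condition forces [j' = l], which completes the
    factor. *)
Definition extends := exists j' a',
  [/\ sg k j * mon a ~= sg k j' * mon a', btw k v j' & nxt v j' = nxt v l].

Lemma extendsI j' i i' z : z \in a -> nxt v j' = nxt v l ->
  sg k j * sg z.1 z.2 ~= sg k j' * sg i i' -> extends.
Proof.
move=> za nj' h; exists j', ((i, i') :: rem z a).
split=> //; last exact: btw_nxt (esym nj') bkl.
by rewrite (mon_rem za) mon_cons !mulrA; apply: congM h (cong_refl _ _).
Qed.

(* The required half occurs on the geodesic from [v] to [j] itself, backwards:
   reversing the piece between [v] and [x] gives a geodesic with the same colors. *)
Lemma extends_reverse g x : g \in Gam -> btw v x j -> x != v -> g x = v ->
  nxt v (g v) = nxt v l -> extends.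
Proof.
move=> gG bx xv gx ngv.
have gvv : g v != v by rewrite -{2}gx (inj_eq perm_inj) eq_sym.
have bkgv : btw k v (g v) by apply: btw_nxt (esym ngv) bkl.
have nx := not_btw_aut gG xv gx.
have b1 : btw (g v) v (g j) by rewrite -{2}gx btw_aut.
have b2 : btw v (g v) (g (g j)).
  by rewrite -{1}gx btw_aut //; apply: (btw_sideL b1); rewrite btwC.
have b3 : btw k v (g (g j)) by apply: (btw_extendl bkgv b2); rewrite eq_sym.
(* [g * g] carries [x] to [g v], so the piece from [x] to [j] continues the reversed piece. *)
exists (g (g j)), a; split=> //; last by rewrite -(nxt_btw b2).
apply: congM (cong_refl _ _); apply/sigma_lin/spath_colorsE => c.
rewrite (ncol_btw _ bkj) (ncol_btw _ bx) (ncol_btw _ b3) (ncol_btw _ b2).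
have -> : ncol c v (g v) = ncol c v x by rewrite -{1}gx ncol_aut // ncolC.
have -> : ncol c (g v) (g (g j)) = ncol c x j by rewrite ncol_aut // -{1}gx ncol_aut.
by rewrite !vcolor_aut.
Qed.

(** The needed half lies further along the geodesic from [k] to [j] itself, so a third geodesic [r],
    avoiding the branch of [j], serves as partner in two exchanges. *)
Lemma extends_same_path g x : g \in Gam -> btw v x j -> x != v -> g x = v ->
  nxt v (g j) = nxt v l -> extends.
Proof.
move=> gG bx xv gx ngj.
have nx := not_btw_aut gG xv gx; have njx := btw_not bx xv; rewrite btwC in njx.
have njgv : ~~ btw j v (g v) := side_trans njx nx.
have b1 : btw (g v) v (g j) by rewrite -{2}gx btw_aut.
have bjl : btw j v l by apply: btw_nxt ngj _; apply: (btw_sideL b1); rewrite btwC.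
(* [g * h] also carries [x] to [v], so [not_btw_aut] keeps both [g v] and [h (g v)] in the branch of
   [x]. *)
have fix_j h : h \in Gam -> h v = v -> ~~ btw j v (h j).
  move=> hG hv; have := @not_btw_aut v x (g * h)%g.
  rewrite groupM // !permM gx hv => /(_ isT xv erefl) nhx.
  apply: side_trans njx _; apply: side_trans nhx _.
  by rewrite -{2}hv btw_aut // btwC.
have [r ra [f [y [fG by_ fy bj1 bj2]]]] := exists_avoiding bkj bkl col_ab bjl fix_j.
have bkgj : btw k v (g j) by apply: btw_nxt (esym ngj) bkl.
have bkx : btw k v x := btw_transl bkj bx.
have vx : v != x by rewrite eq_sym.
have ngk : ~~ btw j v (g k).
  apply: side_trans njgv _; rewrite -{2}gx btw_aut //.
  by apply: btw_not vx; rewrite btwC.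
have b2 : btw (g k) v (g j) by rewrite -gx btw_aut // (btw_trans bkj bx).
have main i0 i1 : sg r.1 r.2 ~= sg i0 i1 -> btw i0 v i1 -> btw j v i0 ->
    btw j v i1 -> btw i1 v (g j) -> extends.
  move=> er b0 bjp bjq bqg; rewrite btwC in b0.
  pose i2 := g^-1%g i0.
  have b3 : btw (g k) v i0 := btw_sideL bjp ngk.
  have b4 : btw v x i2.
    by rewrite -(btw_aut _ _ _ gG) gx permKV; apply: btw_sideL bjp njgv.
  have b5 : btw k v i2 := btw_extendl bkx b4 vx.
  have b6 : btw i1 v i2.
    rewrite btwC; apply: (btw_sideL bjq); apply: side_trans njx _.
    exact: btw_not b4 xv.
  apply: (extendsI (j' := g j) (i := i1) (i' := i2) ra ngj).
  (* After [g] brings [x] to [v], the half towards [g j] passes to [r]; then [g^-1%g] restores [k],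
     and an exchange at [v] joins [k] to [g j]. *)
  apply: cong_trans (congM (sigma_aut k j gG) er) _; rewrite (sigmaC i0 i1).
  apply: cong_trans (sigma_swap b2 b0 b3 bqg) _.
  have e : sg (g k) i0 ~= sg k i2.
    by apply: cong_sym; have := sigma_aut k i2 gG; rewrite permKV.
  apply: cong_trans (congM e (cong_refl _ _)) _.
  exact: sigma_swap b5 bqg bkgj b6.
have er := sigma_aut r.1 r.2 fG.
have bf : btw (f r.1) v (f r.2) by rewrite -fy btw_aut.
have [b3|b3] := orP (btw_cut (g j) bf).
  by apply: (main (f r.2) (f r.1)); rewrite // ?(sigmaC (f r.2)) // btwC.
by apply: (main (f r.1) (f r.2)); rewrite // btwC.
Qed.

(** The exchange with [z] is blocked only if the stabilizer of [v] keeps [j] in the branch of [i'].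
    Then some visit avoids that branch: on another factor it mediates two exchanges, on [z] itself
    it allows the geodesic of [z] to be rearranged. *)
Lemma extends_other i' j' z g : z \in a -> g \in Gam ->
  z = (g i', g j') \/ z = (g j', g i') ->
  btw i' v j' -> nxt v j' = nxt v l -> extends.
Proof.
move=> za gG zE bij' nj'.
have bkj' : btw k v j' by apply: btw_nxt (esym nj') bkl.
have ez : sg z.1 z.2 ~= sg i' j'.
  apply: cong_sym; case: zE => -> /=; first exact: sigma_aut.
  by rewrite sigmaC; apply: sigma_aut.
have [/existsP[h /and3P[hG /eqP hv bh]]|] :=
    boolP [exists h : {perm 'I_n}, [&& h \in Gam, h v == v & btw i' v (h j)]].
  apply: (extendsI (j' := j') (i := i') (i' := h j) za nj').
  apply: cong_trans (congM (cong_refl _ _) ez) _.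
  have := @sigma_swap_stab v k j i' j' 1%g h; rewrite !perm1.
  by apply=> //; rewrite group1.
move=> /existsPn nh.
have {}nh h : h \in Gam -> h v = v -> ~~ btw i' v (h j).
  by move=> hG hv; have := nh h; rewrite hG hv eqxx.
have nij : ~~ btw i' v j by have := nh 1%g; rewrite !perm1; apply.
have nji : ~~ btw j v i' by rewrite btwC.
have fix_j h : h \in Gam -> h v = v -> ~~ btw j v (h j).
  by move=> hG hv; apply: side_trans nji (nh h hG hv).
have bjl : btw j v l by apply: btw_nxt nj' (btw_sideL bij' nij).
have [r ra [f0 [y0 [f0G by0 fy0 bj1 bj2]]]] := exists_avoiding bkj bkl col_ab bjl fix_j.
have [erz|nrz] := eqVneq r z; last first.
  have rza : r \in rem z a by apply: rem_mem.
  have main i0 i1 : sg r.1 r.2 ~= sg i0 i1 -> btw i0 v i1 -> btw j v i0 ->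
      btw j v i1 -> btw i1 v j' -> extends.
    move=> er b0 bjp bjq bqj'.
    exists j', ((i1, j) :: (i', i0) :: rem r (rem z a)); split=> //.
    rewrite (mon_rem za) (mon_rem rza) !mon_cons /=.
    have e1 : sg z.1 z.2 * sg r.1 r.2 ~= sg i' i0 * sg i1 j'.
      apply: cong_trans (congM ez er) _; rewrite (sigmaC i0 i1) btwC in b0 *.
      by apply: (sigma_swap bij' b0 _ bqj'); apply: btw_sideL bjp nji.
    have e2 : sg k j * sg i1 j' ~= sg k j' * sg i1 j.
      by apply: (sigma_swap bkj bqj' bkj'); rewrite btwC.
    move: (mon _) => M.
    have -> : sg k j * (sg z.1 z.2 * (sg r.1 r.2 * M)) =
              sg z.1 z.2 * sg r.1 r.2 * (sg k j * M) by ring.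
    apply: cong_trans (congM e1 (cong_refl _ _)) _.
    have -> : sg i' i0 * sg i1 j' * (sg k j * M) =
              sg k j * sg i1 j' * (sg i' i0 * M) by ring.
    by apply: cong_trans (congM e2 (cong_refl _ _)) _; rewrite -mulrA; apply: cong_refl.
  have er := sigma_aut r.1 r.2 f0G.
  have bf : btw (f0 r.1) v (f0 r.2) by rewrite -fy0 btw_aut.
  have [b3|b3] := orP (btw_cut j' bf).
    by apply: (main (f0 r.2) (f0 r.1)); rewrite // ?(sigmaC (f0 r.2)) // btwC.
  by apply: (main (f0 r.1) (f0 r.2)); rewrite // btwC.
have [y [f [fG by_ fy bj1' bj2']]] : exists y f,
    [/\ f \in Gam, btw i' y j', f y = v, btw j v (f i') & btw j v (f j')].
  exists (g^-1%g y0), (g * f0)%g; rewrite !permM permKV groupM //.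
  move: by0 bj1 bj2; rewrite erz -(btw_aut _ _ _ (groupVr gG)).
  by case: zE => -> /= b1 b2 b3; split=> //; move: b1; rewrite !permK // btwC.
have yv : y != v.
  apply/eqP => e; rewrite e in fy; move: bj1'; apply/negP.
  apply: side_trans (fix_j f fG fy) _.
  by rewrite -{1}fy btw_aut.
have nyf := not_btw_aut fG yv fy; have vy : v != y by rewrite eq_sym.
(* With [y] on the side of [i'], the branch of [j] would contain [i'], [y], [f v] and [f j'] in
   turn, against [bj2']. *)
have [b1|b1] := orP (btw_cut y bij'); last first.
  have b2 : btw v y i' by rewrite btwC; apply: btw_transl by_ b1.
  have n1 := btw_not b2 yv; rewrite btwC in n1.
  have n2 := btw_not b1 vy.
  rewrite -(btw_aut _ _ _ fG) fy in n2.
  by have := side_trans nji (side_trans n1 (side_trans nyf n2)); rewrite bj2'.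
have b2 : btw v y j' := btw_mid b1 by_.
pose i2 := f^-1%g i'.
have b3 : btw (f j') v y.
  rewrite btwC; apply: (@btw_sideL _ (f v)); last by rewrite btwC.
  by rewrite -{2}fy btw_aut.
have b4 : btw v y i2.
  rewrite -(btw_aut _ _ _ fG) fy permKV btwC.
  by apply: (btw_sideR b1); rewrite btwC.
have b5 : btw (f j') v i2 := btw_extendl b3 b4 vy.
have ni2 : nxt v i2 = nxt v l by rewrite -(nxt_btw b4) // (nxt_btw b2).
have bki2 : btw k v i2 by apply: btw_nxt (esym ni2) bkl.
(* The outer pieces trade places around the piece from [v] to [y]: [f] brings the one from [y] to
   [j'] to [v], outside the branch of [j], and its inverse brings the one from [v] to [i'] to
   [y]. *)
have e : sg i' j' ~= sg (f j') i2.
  apply/sigma_lin/spath_colorsE => c.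
  rewrite (ncol_btw _ bij') (ncol_btw _ b2) (ncol_btw _ b5) (ncol_btw _ b4).
  have -> : ncol c (f j') v = ncol c y j' by rewrite -fy ncol_aut // ncolC.
  have -> : ncol c y i2 = ncol c i' v.
    by rewrite -(ncol_aut _ _ _ fG) fy permKV ncolC.
  have -> : vcolor G i2 = vcolor G i' by rewrite -(vcolor_aut _ fG) permKV.
  rewrite vcolor_aut // (addnC (vcolor G i' == c)); congr (_ + _)%N.
  by rewrite addnA addnC (addnC (ncol c i' v)).
apply: (extendsI (j' := i2) (i := f j') (i' := j) za ni2).
apply: cong_trans (congM (cong_refl _ _) (cong_trans ez e)) _.
by apply: (sigma_swap bkj b5 bki2); rewrite btwC.
Qed.

Lemma extendsP : extends.
Proof.
have [[h hG [hv nh]]|[z za [g [x [gG bx gx hg]]]]|[g [x [gG bx xv gx [h|h]]]]] :=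
    exists_half bkj bkl col_ab.
- exists (h j), a; have b1 : btw k v (h j) by apply: btw_nxt (esym nh) bkl.
  split=> //; apply: congM (cong_refl _ _).
  have := @sigma_half_aut 1%g 1%g 1%g h v k j; rewrite !perm1.
  by apply=> //; rewrite group1.
- have bg : btw (g z.1) v (g z.2) by rewrite -gx btw_aut.
  case: hg => hg.
    apply: (@extends_other (g z.2) (g z.1) z g^-1%g) => //; rewrite ?groupV //.
      by right; rewrite !permK; case: (z).
    by rewrite btwC.
  apply: (@extends_other (g z.1) (g z.2) z g^-1%g) => //; rewrite ?groupV //.
  by left; rewrite !permK; case: (z).
- exact: extends_reverse gG bx xv gx h.
- exact: extends_same_path gG bx xv gx h.
Qed.

End Step.

(** * The kernel of the shortest path map *)

Definition tmon (s : seq C) : color_ring R C := \prod_(c <- s) tvar R c.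

Lemma tmonE s :
  tmon s = 'X_[[multinom count_mem (enum_val i) s | i < #|C|]].
Proof.
rewrite /tmon; elim: s => [|c s IH].
  rewrite big_nil -mpolyX0; apply: (congr1 (@mpolyX _ R)); apply/mnmP => i.
  by rewrite mnm0E.
rewrite big_cons IH /tvar -mpolyXD; apply: (congr1 (@mpolyX _ R)); apply/mnmP => i.
rewrite mnmDE mnm1E !mnmE /=; congr (nat_of_bool _ + _)%N.
by apply/eqP/eqP => [<-|->]; rewrite ?enum_rankK ?enum_valK.
Qed.

Lemma tmon_inj s s' : tmon s = tmon s' -> perm_eq s s'.
Proof.
rewrite !tmonE => /mpolyP/(_ [multinom count_mem (enum_val i) s | i < #|C|]).
rewrite !mcoeffX eqxx; case: eqP => [e _|_ /eqP]; last by rewrite oner_eq0.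
apply/allP => c _; apply/eqP => /=; move/mnmP: e => /(_ (enum_rank c)).
by rewrite !mnmE enum_rankK => ->.
Qed.

Local Notation phi := (@shortest_path_map R n C G).

Lemma phiB : {morph phi : f g / f - g}.
Proof. by move=> f g; apply: comp_mpolyB. Qed.

Lemma phiM : {morph phi : f g / f * g}.
Proof. by move=> f g; apply: rmorphM. Qed.

Lemma phi_sigma i j : phi (sg i j) = tmon (spath_colors G i j).
Proof.
have monE x y : spath_monomial R G x y = tmon (spath_colors G x y).
  by rewrite /tmon !big_cons big_map mulrA.
rewrite /shortest_path_map /comp_mpoly mmapX mmap1U tnth_mktuple enum_rankK /=.
case: leqP => _ /=; rewrite monE //.
exact: perm_big (spath_colorsC _ _).
Qed.

Lemma phi_mon a : phi (mon a) = tmon (color_seq a).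
Proof.
rewrite /tmon /color_seq big_flatten big_map /mon /shortest_path_map rmorph_prod.
by apply: eq_bigr => z _; apply: phi_sigma.
Qed.

Lemma phi_ideal f : ideal_generated (@path_binomials R n C G) f -> phi f = 0.
Proof.
move=> [m [c [g [Sg ->]]]].
have -> : phi (\sum_(s < m) c s * g s) = \sum_(s < m) phi (c s * g s).
  exact: raddf_sum.
rewrite big1 // => s _; rewrite phiM.
suff -> : phi (g s) = 0 by rewrite mulr0.
case: (Sg s) => -[i [j [k [l [h ->]]]]].
  rewrite phiB !phiM !phi_sigma.
  apply/eqP; rewrite subr_eq0; apply/eqP; rewrite /tmon -!big_cat.
  apply: perm_big; apply/seq.permP => P.
  have := seq.permP (perm_map (ecolor G) h) P; rewrite !map_cat !count_cat /=.
  by lia.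
rewrite phiB !phi_sigma.
by apply/eqP; rewrite subr_eq0; apply/eqP; apply: perm_big.
Qed.

(** The color hypothesis thus survives every rewriting of [a] modulo the binomials. *)
Lemma cong_colors a b : mon a ~= mon b -> perm_eq (color_seq a) (color_seq b).
Proof.
move=> /phi_ideal; rewrite phiB !phi_mon.
by move/eqP; rewrite subr_eq0 => /eqP/tmon_inj.
Qed.

(** Vertex colors are not edge colors, so the color of [k] in [a] comes from an endpoint of a
    factor, which an automorphism moves to [k]. *)
Lemma exists_start k l a b :
  perm_eq (color_seq a) (color_seq ((k, l) :: b)) ->
  exists j a', mon a ~= sg k j * mon a'.
Proof.
case: Grcop => Gdisj Gv _ pab.
have : vcolor G k \in color_seq a by rewrite (perm_mem pab) inE eqxx.
case/flattenP => s /mapP[z za ->]; rewrite !inE (mon_rem za).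
have start i j : sg z.1 z.2 = sg i j -> vcolor G k = vcolor G i ->
    exists j a', sg z.1 z.2 * mon (rem z a) ~= sg k j * mon a'.
  move=> ez /esym/Gv[g gG <-]; exists (g j), (rem z a).
  by rewrite ez; apply: congM (cong_refl _ _); apply: sigma_aut.
case/or3P => [/eqP e|/eqP e|/mapP[e /spath_edges_sub eE /(Gdisj _ _ eE) //]].
  exact: start e.
by apply: start e; rewrite sigmaC.
Qed.

Lemma exists_pair k l a b :
  perm_eq (color_seq a) (color_seq ((k, l) :: b)) ->
  exists a', mon a ~= sg k l * mon a'.
Proof.
move=> pab.
have colE j a' : mon a ~= sg k j * mon a' ->
    perm_eq (color_seq ((k, j) :: a')) (color_seq ((k, l) :: b)).
  move=> e; apply: perm_trans pab; rewrite perm_sym; apply: cong_colors.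
  by rewrite mon_cons.
have prefix m : (m <= gdist k l)%N -> exists v j a',
    [/\ mon a ~= sg k j * mon a', gdist k v = m, btw k v l & btw k v j].
  elim: m => [|m IH] lem.
    have [j [a' e]] := exists_start pab.
    by exists k, j, a'; rewrite gdistxx !btwxx.
  have [v [j [a' [e dv bvl bvj]]]] := IH (ltnW lem).
  have [j' [a'' [e' bvj' nj']]] := extendsP bvj bvl (colE _ _ e).
  have vl : v != l by apply/eqP => vl; move: lem; rewrite -vl dv ltnn.
  have vj' : v != j'.
    apply/eqP => vj; move: nj'; rewrite -vj nxtxx => /esym/nxt_eq lv.
    by rewrite lv eqxx in vl.
  have [aw bw _] := nxtP vl; have [_ bw' _] := nxtP vj'; rewrite nj' in bw'.
  exists (nxt v l), j', a''; split.
  - exact: cong_trans e e'.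
  - by have /eqP <- := btw_transl bvl bw; rewrite dv gdist_adj // addn1.
  - exact: btw_trans bvl bw.
  - exact: btw_trans bvj' bw'.
have [v [j [a' [e dv bvl bvj]]]] := prefix _ (leqnn _).
have evl : v = l by apply: gdist_eq0; move/eqP: bvl; rewrite dv; lia.
(* A last step at [v = l] makes the geodesic end there. *)
have [j' [a'' [e' bvj' nj']]] := extendsP bvj bvl (colE _ _ e).
move: nj'; rewrite evl nxtxx => /nxt_eq ej; exists a''.
by rewrite -ej; apply: cong_trans e e'.
Qed.

Lemma mon_cong a b : perm_eq (color_seq a) (color_seq b) -> mon a ~= mon b.
Proof.
elim: b a => [|[k l] b IH] a pab.
  by case: a pab => [_|z a /perm_size //]; apply: cong_refl.
have [a' e] := exists_pair pab; apply: (cong_trans e).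
rewrite mon_cons; apply: congM (cong_refl _ _) (IH _ _).
have : perm_eq (color_seq ((k, l) :: a')) (color_seq ((k, l) :: b)).
  apply: perm_trans pab; rewrite perm_sym; apply: cong_colors.
  by rewrite mon_cons.
by rewrite !color_seq_cons perm_cat2l.
Qed.

Definition mseq (m : 'X_{1..#|{: upair n}|}) : seq ('I_n * 'I_n) :=
  flatten [seq nseq (m i) (val (enum_val i)) | i <- enum 'I_#|{: upair n}|].

Lemma monomial_mon m : 'X_[m] = mon (mseq m).
Proof.
rewrite mpolyXE_id /mon /mseq big_flatten big_map big_enum /=.
apply: eq_bigr => i _; rewrite big_nseq -Monoid.iteropE.
rewrite /sigma; set e := mk_upair _ _.
have -> : e = enum_val i.
  apply: val_inj; rewrite /e /=; case: (enum_val i) => -[x y] /= xy.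
  by rewrite xy.
by rewrite enum_valK.
Qed.

(** A monomial [m] of [f] shares its image with another monomial [m'] of [f], as its coefficient
    would otherwise survive in [phi f]. Subtracting a multiple of their difference, which [mon_cong]
    puts in the ideal, shrinks the support. *)
Lemma ker_ideal f : phi f = 0 -> ideal_generated (@path_binomials R n C G) f.
Proof.
have [N] := ubnP (size (msupp f)); elim: N f => // N IH f leN phi0.
have [->|nz] := eqVneq f 0; first exact: ideal_gen0.
have [m mf] : exists m, m \in msupp f.
  move: nz; rewrite -msupp_eq0; case: (msupp f) => // m s _.
  by exists m; rewrite inE eqxx.
pose mu m := [multinom count_mem (enum_val i) (color_seq (mseq m)) | i < #|C|].
have phiX m1 : phi 'X_[m1] = 'X_[mu m1] by rewrite monomial_mon phi_mon tmonE.
have [/hasP[m' m'f /andP[nm /eqP em]]|/hasPn no] :=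
    boolP (has (fun m' => (m' != m) && (mu m' == mu m)) (msupp f)); last first.
  have : (phi f)@_(mu m) = f@_m.
    rewrite /shortest_path_map comp_mpolyEX raddf_sum /=.
    rewrite (bigD1_seq m) //= mcoeffZ -/(phi _) phiX mcoeffX eqxx mulr1.
    rewrite big_seq_cond big1 ?addr0 // => m1 /andP[m1f nm1].
    rewrite mcoeffZ -/(phi _) phiX mcoeffX; move: (no _ m1f).
    by rewrite nm1 /= => /negPf ->; rewrite mulr0.
  rewrite phi0 mcoeff0 => /esym/eqP; rewrite mcoeff_eq0.
  by rewrite mf.
have cmm : 'X_[m] ~= 'X_[m'].
  rewrite !monomial_mon; apply: mon_cong; apply: tmon_inj.
  by rewrite -!phi_mon -!monomial_mon !phiX em.
pose h : sigma_ring R n := 'X_[m] - 'X_[m'].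
have -> : f = (f - f@_m *: h) + (f@_m)%:MP * h by rewrite mul_mpolyC subrK.
apply: ideal_genD; last exact: ideal_genM.
apply: IH; last first.
  rewrite phiB phi0 /shortest_path_map comp_mpolyZ -/(phi _) phiB !phiX em.
  by rewrite subrr scaler0 subr0.
apply: leq_trans (_ : size (rem m (msupp f)) < N)%N; last first.
  by rewrite size_rem // prednK -?has_predT //; case: (msupp f) mf.
rewrite ltnS; apply: uniq_leq_size (msupp_uniq _) _ => x.
rewrite mem_rem_uniq ?msupp_uniq // !inE !mcoeff_msupp.
rewrite mcoeffB mcoeffZ /h mcoeffB !mcoeffX => nx.
have nxm : x != m.
  apply: contraNneq nx => ->; rewrite eqxx (negPf nm) subr0 mulr1 subrr.
  by rewrite eqxx.
rewrite nxm /=; apply: contraNneq nx => x0.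
rewrite x0 (eq_sym m) (negPf nxm) !sub0r mulrN opprK.
have [e|_] := eqVneq m' x; last by rewrite mulr0.
by move: m'f; rewrite mcoeff_msupp e x0 eqxx.
Qed.

End Moves.

End RcopBlockGraph.

Theorem theorem7p1 (R : realType) (n : nat) (C : finType)
  (G : colored_graph n C)
  (Gconnected : connected_graph G) (Grcop : rcop G) (Gblock : block_graph G) :
  markov_basis (@path_binomials R n C G) (@ker_shortest_path_map R n C G).
Proof.
split=> [f [] [i [j [k [l [_ ->]]]]]|f]; last first.
- by split; [apply: ker_ideal | apply: phi_ideal].
- by do 2 eexists; reflexivity.
- by do 2 eexists; rewrite /sigma -!mpolyXD.
Qed.
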